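(* Let $A=(a_{ij})$ be a symmetric $n\times n$ matrix. Then the following hold. (Local improvement.) $\lambda^{S}_{G}(A)>\lambda_G(A)$ if and only if, for every $i$ with $d_i(A,0)=\lambda_G(A)$, row $i$ of the matrix $A$ has at least $\lfloor n/2-1\rfloor$ positive numbers. Likewise, $\rho^{S}_{G}(A)<\rho_G(A)$ if and only if, for every $i$ with $D_i(A,0)=\rho_G(A)$, row $i$ of the matrix $A$ has at least $\lfloor n/2-1\rfloor$ negative numbers. (Global bounds.) Each of the functions $\lambda_G(A-x\mathbf 1)$ and $\rho_G(A-x\mathbf 1)$ of $x$ can be written as a single piecewise-linear function. Alternatively, these functions can be written as cut out by $n$ lines, i.e. $$\lambda_G(A-x\mathbf 1)=\min_{k=1}^{n}(r_kx+s_k),\qquad \rho_G(A-x\mathbf 1)=\max_{k=1}^{n}(R_kx+S_k).$$ (Convexity.) It follows that the functions $-\lambda_G(A-x\mathbf 1)$ and $\rho_G(A-x\mathbf 1)$ are convex in $x$, i.e. $\lambda_G(A-x\mathbf 1)$ is concave down and $\rho_G(A-x\mathbf 1)$ is concave up in $x$. From this it follows that the minimizer is attained at a unique value, or perhaps on a unique closed interval.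
   Context: All matrices are symmetric with real entries, and $\mathbf 1$ denotes the $n\times n$ matrix with all entries equal to $1$. For an $n\times n$ matrix $A=(a_{ij})$ put $R_i(A)=\sum_{j\ne i}|a_{ij}|$. The Gershgorin bounds are $$\lambda_G(A)=\min_i(a_{ii}-R_i(A)),\qquad \rho_G(A)=\max_i(a_{ii}+R_i(A)),$$ and the shifted Gershgorin bounds are $$\lambda^{S}_G(A)=\sup_{x\ge0}\lambda_G(A-x\mathbf 1),\qquad \rho^{S}_G(A)=\inf_{x\le0}\rho_G(A-x\mathbf 1).$$ Define $$d_i(A,x)=a_{ii}-x-\sum_{j\ne i}|a_{ij}-x|,\qquad D_i(A,x)=a_{ii}-x+\sum_{j\ne i}|a_{ij}-x|.$$ For $k=1,\dots,n$ set $r_k=n-2k$ and $R_k=2k-n-2$ (the constants $R_k$ are distinct from the row sums $R_i(A)$). For each $i=1,\dots,n$, let $y_1\le y_2\le\dots\le y_{n-1}$ be the off-diagonal entries of row $i$ of $A$ in nondecreasing order, and for $k=1,\dots,n$ set $$\delta_{i,k}=\sum_{j<k}y_j-\sum_{j\ge k}y_j,\qquad s_{i,k}=a_{ii}+\delta_{i,k},\qquad S_{i,k}=a_{ii}-\delta_{i,k}.$$ Finally $s_k=\min_i s_{i,k}$ and $S_k=\max_i S_{i,k}$.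
   Formalization: The threshold ⌊n/2−1⌋, false for the zero 2×2 matrix, is replaced by ⌊n/2+1⌋, counting only off-diagonal entries; minimizers are treated on the half-lines x≥0, x≤0 for all n, and on the whole line only for n≥2 (a closed half-line if n=2), as none exists for n=1. *)

(* Defs.v *)
From mathcomp Require Import all_boot all_order all_algebra.
From mathcomp Require Import all_classical all_reals all_analysis.

Set Implicit Arguments.
Unset Strict Implicit.
Unset Printing Implicit Defensive.
Import Order.TTheory GRing.Theory Num.Theory.

Local Open Scope classical_set_scope.
Local Open Scope ring_scope.

(* Matrices are 'M[R]_n.+1, so that the minima and maxima over rows range over
   a nonempty set: the size written n in mathematical prose is n.+1 here. *)

Definition fmin (R : realType) (n : nat) (f : 'I_n.+1 -> R) : R :=
  \big[Num.min/f ord0]_(i < n.+1) f i.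

Definition fmax (R : realType) (n : nat) (f : 'I_n.+1 -> R) : R :=
  \big[Num.max/f ord0]_(i < n.+1) f i.

Definition offdiag_sum (R : realType) (n : nat) (A : 'M[R]_n.+1)
    (i : 'I_n.+1) : R :=
  \sum_(j < n.+1 | j != i) `|A i j|.

Definition gersh_lambda (R : realType) (n : nat) (A : 'M[R]_n.+1) : R :=
  fmin (fun i => A i i - offdiag_sum A i).

Definition gersh_rho (R : realType) (n : nat) (A : 'M[R]_n.+1) : R :=
  fmax (fun i => A i i + offdiag_sum A i).

Definition shift_ones (R : realType) (n : nat) (A : 'M[R]_n.+1) (x : R) :
    'M[R]_n.+1 :=
  A - x *: const_mx 1.

(* The two sets are nonempty and bounded on the relevant side by A i i, for any
   i, so the real-valued sup and inf are the genuine ones. *)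
Definition shifted_lambda (R : realType) (n : nat) (A : 'M[R]_n.+1) : R :=
  sup [set gersh_lambda (shift_ones A x) | x in [set x : R | 0 <= x]].

Definition shifted_rho (R : realType) (n : nat) (A : 'M[R]_n.+1) : R :=
  inf [set gersh_rho (shift_ones A x) | x in [set x : R | x <= 0]].

Definition d_low (R : realType) (n : nat) (A : 'M[R]_n.+1) (i : 'I_n.+1)
    (x : R) : R :=
  A i i - x - \sum_(j < n.+1 | j != i) `|A i j - x|.

Definition D_up (R : realType) (n : nat) (A : 'M[R]_n.+1) (i : 'I_n.+1)
    (x : R) : R :=
  A i i - x + \sum_(j < n.+1 | j != i) `|A i j - x|.

Definition npos (R : realType) (n : nat) (A : 'M[R]_n.+1) (i : 'I_n.+1) : nat :=
  #|[pred j : 'I_n.+1 | (j != i) && (0 < A i j)]|.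

Definition nneg (R : realType) (n : nat) (A : 'M[R]_n.+1) (i : 'I_n.+1) : nat :=
  #|[pred j : 'I_n.+1 | (j != i) && (A i j < 0)]|.

(* With m the size of the matrix, the right derivative of d_low A i at 0 is
   2 * npos A i - m and the left derivative of D_up A i at 0 is
   m - 2 * nneg A i.  A row improves, i.e. the count exceeds m / 2, exactly when
   the count is at least floor (m / 2 + 1).  The source prints
   floor (m / 2 - 1) instead, which is refuted by the zero 2 x 2 matrix: every
   row has at least 0 positive entries, but the Gershgorin lower bound of
   0 - x 1 is -2x, which no x >= 0 improves.  The diagonal entry is not counted
   because its sign plays no role in these derivatives. *)
Definition improvement_threshold (R : realType) (m : nat) : int :=
  Num.floor (m%:R / 2 + 1 : R).

Definition r_slope (R : realType) (m k : nat) : R := m%:R - 2 * k%:R.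

Definition R_slope (R : realType) (m k : nat) : R := 2 * k%:R - m%:R - 2.

Definition sorted_offdiag (R : realType) (n : nat) (A : 'M[R]_n.+1)
    (i : 'I_n.+1) : seq R :=
  sort <=%O [seq A i j | j <- enum 'I_n.+1 & j != i].

(* 1-based: y_off A i 1 <= ... <= y_off A i n. *)
Definition y_off (R : realType) (n : nat) (A : 'M[R]_n.+1) (i : 'I_n.+1)
    (j : nat) : R :=
  (sorted_offdiag A i)`_j.-1.

Definition delta (R : realType) (n : nat) (A : 'M[R]_n.+1) (i : 'I_n.+1)
    (k : nat) : R :=
  \sum_(1 <= j < k) y_off A i j - \sum_(k <= j < n.+1) y_off A i j.

Definition s_row (R : realType) (n : nat) (A : 'M[R]_n.+1) (i : 'I_n.+1)
    (k : nat) : R :=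
  A i i + delta A i k.

Definition S_row (R : realType) (n : nat) (A : 'M[R]_n.+1) (i : 'I_n.+1)
    (k : nat) : R :=
  A i i - delta A i k.

Definition s_min (R : realType) (n : nat) (A : 'M[R]_n.+1) (k : nat) : R :=
  fmin (fun i => s_row A i k).

Definition S_max (R : realType) (n : nat) (A : 'M[R]_n.+1) (k : nat) : R :=
  fmax (fun i => S_row A i k).

(* The breakpoints b cut the line into size b + 1 closed pieces, the k-th one
   lying between b`_(k-1) (or -oo) and b`_k (or +oo).  Consecutive pieces share
   their endpoint, so f is continuous. *)
Definition piecewise_linear (R : realType) (f : R -> R) : Prop :=
  exists b : seq R, sorted <%O b /\
    forall k : nat, (k <= size b)%N ->
      exists m c : R, forall x : R,
        (nth -oo (-oo :: map EFin b) k <= x%:E)%E ->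
        (x%:E <= nth +oo (map EFin b) k)%E ->
        f x = m * x + c.

Definition convex_on_line (R : realType) (f : R -> R) : Prop :=
  @convex_function R R^o [set: R] f.

Definition minimizers (R : realType) (D : set R) (f : R -> R) : set R :=
  [set x | D x /\ forall y, D y -> f x <= f y].

(* p.1 = p.2 is the case of a unique minimizer. *)
Definition min_on_unique_segment (R : realType) (D : set R) (f : R -> R) :
    Prop :=
  exists! p : R * R, p.1 <= p.2 /\ minimizers D f = `[p.1, p.2]%classic.

(* Main.v *)
Require Import Defs.
From mathcomp Require Import all_boot all_order all_algebra.
From mathcomp Require Import all_classical all_reals all_analysis.
From mathcomp Require Import ring lra.
Import Order.TTheory GRing.Theory Num.Theory.
Local Open Scope classical_set_scope.
Local Open Scope ring_scope.

(** Fix a row i and let y_1 <= ... <= y_(m-1) be its sorted off-diagonal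
    entries, m being the size of the matrix.  For every cut k, the sum of the
    distances |y_j - x| is at least the signed sum in which the first k - 1
    terms are x - y_j and the others y_j - x, and the cut located at x gives
    equality.  Hence the sum of distances is the maximum of m affine functions
    of x ([sum_dist_sorted]), whose slopes depend on k only.  The functions
    - d_i and D_i are therefore maxima over k of affine functions with
    slopes that do not depend on the row, and exchanging the maximum over k with
    the maximum over the rows yields the two formulas with m lines
    ([opp_gersh_lambda_max_affine], [gersh_rho_max_affine]).

    All the global statements then hold for any function [max_affine a c], the
    maximum of finitely many affine functions.  It is convex and continuous.  It
    is piecewise linear because, on an interval whose interior contains no
    crossing of two of the lines, the line that is maximal at one interior point
    stays maximal ([max_affine_piecewise_linear]).  On a closed interval where
    every unbounded direction is climbed by one of the lines, sublevel sets are
    compact intervals, so the set of minimizers is a segment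
    ([max_affine_min_on_segment]).  The slopes r_k and R_k take both signs as
    soon as m >= 3, and on each half-line a slope of the needed sign exists for
    every m; for m = 2 one of the two lines is horizontal and the minimizers form a
    half-line.

    Local improvement is a statement about one-sided derivatives at 0.  With p
    positive off-diagonal entries in row i, the concave function d_i lies below
    its right tangent at 0, of slope 2p - m ([d_low_le_tangent]), and coincides
    with it near 0 ([d_low_eq_tangent]).  If an active row has p <= m / 2, it
    caps the bound for every x >= 0; if all active rows have p > m / 2, a small
    positive x raises them all while the inactive rows stay above.  The
    statement for rho is the one for lambda applied to - A, since
    D_i(A, x) = - d_i(- A, - x). *)

(** * Finite minima and maxima *)

Section Extrema.
Context {R : realType} {n : nat}.
Implicit Types (f g : 'I_n.+1 -> R) (v : R).

Lemma fmax_leP f v : reflect (forall i, f i <= v) (fmax f <= v).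
Proof.
apply: (iffP (bigmax_leP _ _ _ _)) => [[_ h] i|h]; first exact: h.
by split=> [|i _]; exact: h.
Qed.

Lemma le_fmax f i : f i <= fmax f.
Proof. exact: le_bigmax. Qed.

(** A maximum is identified through one attaining index, so that the default
    value of the iterated maximum never has to be considered. *)
Lemma fmaxP f v : fmax f = v <-> (exists i, f i = v) /\ forall i, f i <= v.
Proof.
have attained : exists i, f i = fmax f.
  rewrite /fmax; elim/big_ind: _ => [|x y [i <-] [j <-]|i _].
  - by exists ord0.
  - by rewrite maxEle; case: ifP => _; [exists j|exists i].
  - by exists i.
split=> [<-|[[i <-] fle]]; first by split=> // i; exact: le_fmax.
by apply/eqP; rewrite eq_le le_fmax andbT; apply/fmax_leP.
Qed.

Lemma fmax_attained f : exists i, f i = fmax f.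
Proof. by have [] := (fmaxP f _).1 erefl. Qed.

Lemma eq_fmax f g : f =1 g -> fmax f = fmax g.
Proof. by move=> /funext ->. Qed.

Lemma fmaxN f : fmax (fun i => - f i) = - fmin f.
Proof. by rewrite /fmin (big_morph _ (@oppr_min R) erefl). Qed.

Lemma fmin_le f i : fmin f <= f i.
Proof. exact: bigmin_le. Qed.

Lemma fmin_attained f : exists i, f i = fmin f.
Proof.
have [i] := fmax_attained (fun i => - f i); rewrite fmaxN => /oppr_inj.
by exists i.
Qed.

Lemma fmax_addl v f : fmax (fun i => v + f i) = v + fmax f.
Proof.
have [i fi] := fmax_attained f.
by apply/fmaxP; split=> [|j]; [exists i; rewrite fi|rewrite lerD2l le_fmax].
Qed.

End Extrema.

Lemma fmax_exchange {R : realType} {m n : nat} (f : 'I_m.+1 -> 'I_n.+1 -> R) :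
  fmax (fun i => fmax (f i)) = fmax (fun j => fmax (f^~ j)).
Proof.
by apply/eqP; rewrite eq_le; apply/andP; split; apply/fmax_leP => i;
   apply/fmax_leP => j; apply: le_trans (le_fmax _ j); exact: (le_fmax _ i).
Qed.

(** * Maxima of finitely many affine functions *)

Section MaxAffine.
Import numFieldNormedType.Exports.
Context {R : realType} {n : nat}.

Definition max_affine (a c : 'I_n.+1 -> R) (x : R) : R :=
  fmax (fun k => a k * x + c k).

Lemma max_affine_convex a c : convex_on_line (max_affine a c).
Proof.
move=> t x y _ _; apply/fmax_leP => k.
have t0 : 0 <= t%:num by []; have t1 : t%:num <= 1 by [].
have -> : a k * conv t x y + c k =
    t%:num * (a k * x + c k) + (1 - t%:num) * (a k * y + c k).
  rewrite (_ : conv t x y = t%:num * x + (1 - t%:num) * y :> R) //.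
  by move: (t%:num) => u; ring.
have line_le z : a k * z + c k <= max_affine a c z.
  exact: (le_fmax (fun k => a k * z + c k)).
by apply: lerD; apply: ler_wpM2l; rewrite ?subr_ge0.
Qed.

(** By induction on the list of indices.  The recursion starts at the line of
    index 0, which is the default value of the maximum. *)
Lemma max_affine_continuous a c : continuous (max_affine a c : R^o -> R^o).
Proof.
have cline k : continuous (fun x : R => a k * x + c k).
  move=> x; apply: cvgD; last exact: cvg_cst.
  by apply: cvgM; [exact: cvg_cst|exact: cvg_id].
rewrite /max_affine /fmax => x.
elim: (index_enum _) => [|k s IH].
  by under eq_fun do rewrite big_nil; exact: cline.
under eq_fun do rewrite big_cons.
by apply: (@continuous_max R R (fun x => a k * x + c k)); [exact: cline|exact: IH].
Qed.

(** Each line is monotone, so it lies below v at z as soon as it does at the end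
    point of the interval where it is the larger. *)
Lemma max_affine_sublevel_interval a c v :
  is_interval [set x | max_affine a c x <= v].
Proof.
move=> x y /fmax_leP xv /fmax_leP yv z /andP[xz zy]; apply/fmax_leP => k.
have [a_ge0|/ltW a_le0] := leP 0 (a k).
  by apply: le_trans (yv k); rewrite lerD2r ler_wpM2l.
by apply: le_trans (xv k); rewrite lerD2r ler_wnM2l.
Qed.

(** A line of negative slope confines the sublevel set of x0 from the left, one
    of positive slope from the right, unless D itself is bounded there.  That
    sublevel set is thus compact: the minimum is attained, and the minimizers
    form a compact interval, that is a segment. *)
Lemma max_affine_min_on_segment a c (D : set R) :
  closed D -> is_interval D -> D !=set0 ->
  has_lbound D \/ (exists k, a k < 0) ->
  has_ubound D \/ (exists k, 0 < a k) ->
  min_on_unique_segment D (max_affine a c).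
Proof.
set f := max_affine a c => Dclosed Ditv [x0 Dx0] Dlow Dup.
have [lo lo_le] : exists lo, forall v : R, D v -> f v <= f x0 -> lo <= v.
  case: Dlow => [[lo loP]|[k ak]]; first by exists lo => v /loP.
  exists ((f x0 - c k) / a k) => v _ /fmax_leP/(_ k) vk.
  by rewrite ler_ndivrMr// mulrC lerBrDr.
have [hi le_hi] : exists hi, forall v : R, D v -> f v <= f x0 -> v <= hi.
  case: Dup => [[hi hiP]|[k ak]]; first by exists hi => v /hiP.
  exists ((f x0 - c k) / a k) => v _ /fmax_leP/(_ k) vk.
  by rewrite ler_pdivlMr// mulrC lerBrDr.
have fcont : continuous f := @max_affine_continuous a c.
have sub_compact v : v <= f x0 -> compact (D `&` [set x | f x <= v]).
  move=> vx0; apply: (@subclosed_compact _ _ `[lo, hi]%classic).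
  - apply: closedI => //; apply: (@closed_comp _ _ f [set y | y <= v]).
      by move=> ? _; exact: fcont.
    exact: closed_le.
  - exact: segment_compact.
  - move=> x [Dx fx]; have fx0 := le_trans fx vx0.
    by rewrite /= in_itv/= lo_le// le_hi.
(* Minimizing over the sublevel set of x0 is minimizing over D. *)
have [z] : exists2 z, z \in D `&` [set x | f x <= f x0] &
    forall t, t \in D `&` [set x | f x <= f x0] -> f z <= f t.
  apply: compact_EVT_min; [by exists x0; split=> /=|exact: sub_compact|].
  exact: continuous_subspaceT.
move=> /set_mem[Dz fz] zmin.
have minE : minimizers D f = D `&` [set x | f x <= f z].
  apply/seteqP; split=> x [Dx fx]; split=> //=; first exact: fx.
  move=> y Dy; apply: le_trans fx _; have [yx0|/ltW] := leP (f y) (f x0).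
    by apply: zmin; rewrite inE.
  exact: le_trans.
set M := minimizers D f in minE *.
have Mcompact : compact M by rewrite minE; exact: sub_compact.
have Mz : M z by rewrite minE; split=> /=.
have [p] : exists2 p, p \in M & forall t, t \in M -> p <= t.
  by apply: (compact_EVT_min (f := id)) => //; [exists z|apply: continuous_subspaceT => ?;
     exact: cvg_id].
have [q] : exists2 q, q \in M & forall t, t \in M -> t <= q.
  by apply: (compact_EVT_max (f := id)) => //; [exists z|apply: continuous_subspaceT => ?;
     exact: cvg_id].
rewrite !inE => Mq qmax Mp pmin.
exists (p, q); split=> [/=|[p' q'] /= [p'q' ME]].
  split; first by apply: pmin; rewrite inE.
  apply/seteqP; split=> x.
    by move=> Mx; rewrite /= in_itv/= pmin ?qmax ?inE.
  rewrite /= in_itv/= => pxq; move: Mp Mq; rewrite minE => -[Dp fp] [Dq fq].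
  rewrite -/M minE; split; first exact: Ditv pxq.
  exact: (@max_affine_sublevel_interval a c (f z) p q).
(* Uniqueness: two segments that are equal as sets have the same ends. *)
have Mp' : M p' by rewrite /M ME /= in_itv/= lexx.
have Mq' : M q' by rewrite /M ME /= in_itv/= lexx p'q'.
have /andP[p'p _] : p' <= p <= q' by move: Mp; rewrite /M ME.
have /andP[_ qq'] : p' <= q <= q' by move: Mq; rewrite /M ME.
by congr pair; apply/eqP; rewrite eq_le ?p'p ?qq' ?pmin ?qmax ?inE.
Qed.

Lemma ereal_open_interval_nonempty {lo hi : \bar R} :
  (lo < hi)%E -> exists x : R, (lo < x%:E < hi)%E.
Proof.
case: lo hi => [l| |] [h| |] //; rewrite ?lte_fin => lh.
- by exists ((l + h) / 2); rewrite !lte_fin !midf_lt.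
- by exists (l + 1); rewrite lte_fin ltry ltrDl ltr01.
- by exists (h - 1); rewrite lte_fin ltNyr ltrBlDr ltrDl ltr01.
- by exists 0; rewrite ltNyr ltry.
Qed.

(** Nondegeneracy provides an interior point of each piece, at which lines can be
    compared; the second part says that no crossing separates that point from
    the rest of the piece. *)
Lemma sorted_pieces {b : seq R} {k} : sorted <%O b -> (k <= size b)%N ->
  let lo := nth -oo%E (-oo%E :: map EFin b) k in
  let hi := nth +oo%E (map EFin b) k in
  (lo < hi)%E /\ forall t, t \in b -> (t%:E <= lo)%E \/ (hi <= t%:E)%E.
Proof.
move=> bsorted kb lo hi.
have bnth i j : (i < j < size b)%N -> b`_i < b`_j.
  case/andP=> ij jb; rewrite (lt_sorted_ltn_nth 0 bsorted) ?inE//.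
  exact: ltn_trans jb.
have hiP : (k < size b)%N /\ hi = (b`_k)%:E \/ (size b <= k)%N /\ hi = +oo%E.
  rewrite /hi; case: (ltnP k (size b)) => k_b; [left|right]; split=> //.
    by rewrite (nth_map 0).
  by rewrite nth_default ?size_map.
have loP : k = 0%N /\ lo = -oo%E \/ exists k', k = k'.+1 /\ lo = (b`_k')%:E.
  rewrite /lo; case: (k) kb => [|k'] k_b; [by left|right].
  by exists k'; rewrite /= (nth_map 0).
move: lo hi loP hiP => lo hi loP hiP; split.
  case: loP hiP => [[_ ->]|[k' [kE ->]]] [[k_b ->]|[_ ->]] //.
  - by rewrite ltNyr.
  - by rewrite lte_fin bnth// k_b kE ltnSn.
  - by rewrite ltry.
move=> t /(nthP 0)[i ib <-]; have [ik|ki] := ltnP i k.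
  left; case: loP => [[kE _]|[k' [kE ->]]]; first by rewrite kE in ik.
  rewrite lee_fin; move: ik; rewrite kE ltnS leq_eqVlt => /predU1P[->//|ik].
  by rewrite ltW// bnth// ik -kE.
right; case: hiP => [[_ ->]|[bk _]]; last first.
  by move: ib; rewrite ltnNge (leq_trans bk ki).
rewrite lee_fin; move: ki; rewrite leq_eqVlt => /predU1P[->//|ki].
by rewrite ltW// bnth// ki.
Qed.

(** The crossing may be x itself but not y, where the comparison is strict; this
    asymmetry lets y be an end of a piece while x is interior to it. *)
Lemma lines_cross {a1 a2 c1 c2 x y : R} :
  a1 * x + c1 <= a2 * x + c2 -> a2 * y + c2 < a1 * y + c1 ->
  (x <= (c2 - c1) / (a1 - a2) < y) \/ (y < (c2 - c1) / (a1 - a2) <= x).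
Proof.
move=> lex lty.
have [a12|a21|a12] := ltgtP a1 a2; last by rewrite a12 in lex lty; lra.
- by right; rewrite ltr_ndivlMr ?ler_ndivrMr ?subr_lt0//; apply/andP; split; lra.
- by left; rewrite ler_pdivlMr ?ltr_pdivrMr ?subr_gt0//; apply/andP; split; lra.
Qed.

(** The breakpoints are all the pairwise crossings; not all of them
    need be kinks of the maximum.  On a piece, the line that is maximal at an
    interior point x0 is maximal everywhere: another line overtaking it would
    cross it inside the piece. *)
Lemma max_affine_piecewise_linear a c : piecewise_linear (max_affine a c).
Proof.
(* Parallel lines contribute the junk breakpoint 0, which is harmless. *)
pose crossing (p : 'I_n.+1 * 'I_n.+1) := (c p.2 - c p.1) / (a p.1 - a p.2).
pose b := sort <=%O (undup [seq crossing p | p <- enum {: 'I_n.+1 * 'I_n.+1}]).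
have crossing_b p : crossing p \in b.
  by rewrite mem_sort mem_undup map_f// mem_enum.
have bsorted : sorted <%O b by rewrite sort_lt_sorted undup_uniq.
exists b; split=> // k kb; have [] := sorted_pieces bsorted kb.
move: (nth -oo%E _ k) (nth +oo%E _ k) => lo hi lohi inner.
have [x0 /andP[lox0 x0hi]] := ereal_open_interval_nonempty lohi.
have [l fx0] := fmax_attained (fun l => a l * x0 + c l).
exists (a l), (c l) => x lox xhi; apply/fmaxP; split; first by exists l.
move=> j; rewrite leNgt; apply/negP => ltj.
have lej : a j * x0 + c j <= a l * x0 + c l.
  by rewrite fx0; exact: (le_fmax (fun l => a l * x0 + c l)).
have := crossing_b (j, l); have := lines_cross lej ltj; rewrite -/(crossing (j, l)).
move: (crossing _) => t cross /inner[tlo|hit]; case: cross => /andP[t1 t2].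
- by have := le_lt_trans tlo lox0; rewrite lte_fin ltNge t1.
- by have := le_trans tlo lox; rewrite lee_fin leNgt t1.
- by have := le_trans xhi hit; rewrite lee_fin leNgt t2.
- by have := lt_le_trans x0hi hit; rewrite lte_fin ltNge t2.
Qed.

End MaxAffine.

Lemma piecewise_linearN {R : realType} (f : R -> R) :
  piecewise_linear (fun x => - f x) -> piecewise_linear f.
Proof.
move=> [b [bsorted lin]]; exists b; split=> // k /lin[m [c fE]].
exists (- m), (- c) => x lox xhi.
by rewrite -[LHS]opprK (fE x lox xhi) opprD mulNr.
Qed.

(** * Each row as a maximum of affine functions *)

Section Rows.
Context {R : realType}.

(** Collecting the terms of slope x and the constants when the first k distances
    are counted as x - y_j and the others as y_j - x. *)
Lemma signed_split_sum (y : seq R) x k : (k <= size y)%N ->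
  (2 * k%:R - (size y)%:R) * x -
    (\sum_(0 <= j < k) y`_j - \sum_(k <= j < size y) y`_j) =
  \sum_(0 <= j < k) (x - y`_j) + \sum_(k <= j < size y) (y`_j - x).
Proof.
move=> ky; rewrite !sumrB !sumr_const_nat subn0 -[x *+ k]mulr_natl.
by rewrite -[x *+ (_ - _)]mulr_natl natrB//; ring.
Qed.

(** Each choice of signs bounds the sum of absolute values from below.  As y is
    sorted, the right signs are given by a cut, at the first entry above x. *)
Lemma sum_dist_sorted {n : nat} (y : seq R) x : sorted <=%O y -> size y = n ->
  \sum_(v <- y) `|v - x| =
  fmax (fun k : 'I_n.+1 => (2 * k%:R - n%:R) * x -
    (\sum_(0 <= j < k) y`_j - \sum_(k <= j < n) y`_j)).
Proof.
move=> ysorted <-; apply/esym/fmaxP; rewrite (big_nth 0) /=; split; last first.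
  move=> k; have ky : (k <= size y)%N by rewrite -ltnS.
  rewrite signed_split_sum// [leRHS](big_cat_nat (n := k))//=.
  apply: lerD; apply: ler_sum => j _; last exact: ler_norm.
  by rewrite distrC ler_norm.
pose k := find (fun v => x < v) y; have ky : (k <= size y)%N := find_size _ _.
exists (Ordinal (ky : (k < (size y).+1)%N)) => /=.
rewrite signed_split_sum// [RHS](big_cat_nat (n := k))//=.
congr +%R; apply: eq_big_nat => j /andP[kj jk].
  rewrite distrC ger0_norm// subr_ge0 leNgt.
  by rewrite (before_find 0 jk).
rewrite ger0_norm// subr_ge0; have k_y := leq_ltn_trans kj jk.
have xk : x < y`_k by apply: nth_find; rewrite has_find.
by apply: le_trans (ltW xk) _; rewrite le_sorted_leq_nth ?inE.
Qed.

Context {n : nat}.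
Implicit Types (A : 'M[R]_n.+1) (i : 'I_n.+1) (x : R).

Lemma size_sorted_offdiag A i : size (sorted_offdiag A i) = n.
Proof.
rewrite size_sort size_map size_filter.
have := count_predC (pred1 i) (enum 'I_n.+1).
by rewrite size_enum_ord (count_uniq_mem _ (enum_uniq _)) mem_enum => -[].
Qed.

Lemma row_dist_sum A i x :
  \sum_(j < n.+1 | j != i) `|A i j - x| =
  fmax (fun k : 'I_n.+1 => (2 * k%:R - n%:R) * x - delta A i k.+1).
Proof.
transitivity (\sum_(v <- sorted_offdiag A i) `|v - x|).
  rewrite /sorted_offdiag (perm_big _ (permEl (perm_sort _ _))) big_map /=.
  by rewrite big_filter big_enum_cond.
rewrite (sum_dist_sorted _ x (sort_le_sorted _) (size_sorted_offdiag A i)).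
by apply: eq_fmax => k; rewrite /delta !big_add1.
Qed.

Lemma d_low_max_affine A i x : - d_low A i x =
  fmax (fun k : 'I_n.+1 => - r_slope R n.+1 k.+1 * x - s_row A i k.+1).
Proof.
rewrite /d_low row_dist_sum opprB addrC -fmax_addl; apply: eq_fmax => k.
by rewrite /r_slope /s_row !mulrSr; ring.
Qed.

Lemma D_up_max_affine A i x : D_up A i x =
  fmax (fun k : 'I_n.+1 => R_slope R n.+1 k.+1 * x + S_row A i k.+1).
Proof.
rewrite /D_up row_dist_sum -fmax_addl; apply: eq_fmax => k.
by rewrite /R_slope /S_row !mulrSr; ring.
Qed.

Lemma gersh_lambda_shift A x :
  gersh_lambda (shift_ones A x) = fmin (fun i => d_low A i x).
Proof.
rewrite /gersh_lambda; congr fmin; apply/funext => i.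
rewrite /d_low /offdiag_sum !mxE mulr1; congr (_ - _).
by apply: eq_bigr => j _; rewrite !mxE mulr1.
Qed.

Lemma gersh_rho_shift A x :
  gersh_rho (shift_ones A x) = fmax (fun i => D_up A i x).
Proof.
rewrite /gersh_rho; congr fmax; apply/funext => i.
rewrite /D_up /offdiag_sum !mxE mulr1; congr (_ + _).
by apply: eq_bigr => j _; rewrite !mxE mulr1.
Qed.

(** The slope of the k-th line is the same in all rows, so the maximum over the
    rows only acts on the constants. *)
Lemma opp_gersh_lambda_max_affine A x : - gersh_lambda (shift_ones A x) =
  max_affine (fun k : 'I_n.+1 => - r_slope R n.+1 k.+1)
    (fun k => - s_min A k.+1) x.
Proof.
rewrite gersh_lambda_shift -fmaxN /max_affine.
under eq_fmax do rewrite d_low_max_affine.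
rewrite fmax_exchange; apply: eq_fmax => k.
by rewrite fmax_addl fmaxN.
Qed.

Lemma gersh_rho_max_affine A x : gersh_rho (shift_ones A x) =
  max_affine (fun k : 'I_n.+1 => R_slope R n.+1 k.+1) (fun k => S_max A k.+1) x.
Proof.
rewrite gersh_rho_shift /max_affine.
under eq_fmax do rewrite D_up_max_affine.
by rewrite fmax_exchange; apply: eq_fmax => k; rewrite fmax_addl.
Qed.

Lemma opp_gersh_lambda_shiftE A :
  (fun x => - gersh_lambda (shift_ones A x)) =
  max_affine (fun k : 'I_n.+1 => - r_slope R n.+1 k.+1) (fun k => - s_min A k.+1).
Proof. by apply/funext => x; exact: opp_gersh_lambda_max_affine. Qed.

Lemma gersh_rho_shiftE A :
  (fun x => gersh_rho (shift_ones A x)) =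
  max_affine (fun k : 'I_n.+1 => R_slope R n.+1 k.+1) (fun k => S_max A k.+1).
Proof. by apply/funext => x; exact: gersh_rho_max_affine. Qed.

Lemma gersh_lambda_shift_min A x : gersh_lambda (shift_ones A x) =
  fmin (fun k : 'I_n.+1 => r_slope R n.+1 k.+1 * x + s_min A k.+1).
Proof.
apply: oppr_inj; rewrite opp_gersh_lambda_max_affine -fmaxN.
by apply: eq_fmax => k /=; rewrite mulNr -opprD.
Qed.

End Rows.

(** * Local improvement *)

Section LocalImprovement.
Context {R : realType} {n : nat}.
Implicit Types (A : 'M[R]_n.+1) (i : 'I_n.+1) (x : R).

(** The floor turns the strict real inequality p > m / 2 into an integer one. *)
Lemma threshold_le A i : (improvement_threshold R n.+1 <= (npos A i)%:Z) =
  (n.+1%:R < 2 * (npos A i)%:R :> R).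
Proof.
rewrite /improvement_threshold -ltzD1 floor_lt_int rmorphD/= ltrD2r.
by rewrite ltr_pdivrMr// mulrC.
Qed.

(** The first-order change, as x increases from 0, of the sum of the distances
    from x to the entries of row i: positive entries get closer, the others
    farther. *)
Lemma sum_row_signs A i x :
  \sum_(j < n.+1 | j != i) (if 0 < A i j then - x else x) =
  (n%:R - 2 * (npos A i)%:R) * x.
Proof.
rewrite (eq_bigr (fun j => x - (if 0 < A i j then 2 * x else 0))); last first.
  by move=> j _; case: ifP => _; ring.
rewrite sumrB -big_mkcondr /=.
have -> : \sum_(j < n.+1 | j != i) x = x *+ n.
  have cn : #|predC1 i| = n by rewrite cardC1 card_ord.
  by rewrite -[in RHS]cn -sumr_const.
have -> : \sum_(j < n.+1 | (j != i) && (0 < A i j)) 2 * x =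
    (2 * x) *+ npos A i.
  by rewrite -sumr_const; apply: eq_bigl.
by rewrite -[x *+ n]mulr_natl -[_ *+ npos A i]mulr_natl; ring.
Qed.

(** Termwise, |a - x| >= a - x for a positive entry and |a - x| = |a| + x for the
    others. *)
Lemma d_low_le_tangent A i x : 0 <= x ->
  d_low A i x <= d_low A i 0 + (2 * (npos A i)%:R - n.+1%:R) * x.
Proof.
move=> x0; have := sum_row_signs A i x.
suff : \sum_(j < n.+1 | j != i) `|A i j - 0| +
    \sum_(j < n.+1 | j != i) (if 0 < A i j then - x else x) <=
    \sum_(j < n.+1 | j != i) `|A i j - x|.
  by rewrite /d_low mulrSr; lra.
rewrite -big_split; apply: ler_sum => j _ /=; rewrite subr0.
case: ltP => [a0|a0]; first by rewrite gtr0_norm// ler_norm.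
by rewrite ler0_norm// distrC (le_trans _ (ler_norm _))// addrC.
Qed.

(** Equality holds as long as x has not passed any positive entry of the row. *)
Lemma d_low_eq_tangent A i :
  \forall x \near 0^'+,
    d_low A i x = d_low A i 0 + (2 * (npos A i)%:R - n.+1%:R) * x.
Proof.
have below_positive : \forall x \near 0^'+, forall j, 0 < A i j -> x <= A i j.
  apply: filter_forall => j; have [a0|_] := ltP 0 (A i j).
    by near do move=> _; apply: nbhs_right_le.
  exact: nearW.
near=> x; have x0 : 0 < x by near: x; exact: nbhs_right_gt.
have x_le : forall j, 0 < A i j -> x <= A i j by near: x.
have := sum_row_signs A i x.
suff : \sum_(j < n.+1 | j != i) `|A i j - 0| +
    \sum_(j < n.+1 | j != i) (if 0 < A i j then - x else x) =
    \sum_(j < n.+1 | j != i) `|A i j - x|.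
  by rewrite /d_low mulrSr; lra.
rewrite -big_split; apply: eq_bigr => j _ /=; rewrite subr0.
case: ltP => [a0|a0].
  by rewrite gtr0_norm// ger0_norm// subr_ge0 x_le.
by rewrite ler0_norm// distrC ger0_norm ?subr_ge0 ?(le_trans a0 (ltW x0))// addrC.
Unshelve. all: by end_near.
Qed.

Lemma gersh_lambdaE A : gersh_lambda A = fmin (fun i => d_low A i 0).
Proof.
by rewrite -gersh_lambda_shift /shift_ones scale0r subr0.
Qed.

(** This needs the set of shifted bounds to be bounded above: d_0 never exceeds
    the diagonal entry when x >= 0. *)
Lemma shifted_lambda_ge A x : 0 <= x ->
  gersh_lambda (shift_ones A x) <= shifted_lambda A.
Proof.
move=> x0; apply: ub_le_sup; last by exists x.
exists (A ord0 ord0) => _ [y /= y0 <-]; rewrite gersh_lambda_shift.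
apply: le_trans (fmin_le _ ord0) _; rewrite /d_low.
have : 0 <= \sum_(j < n.+1 | j != ord0) `|A ord0 j - y| by exact: sumr_ge0.
by lra.
Qed.

(** If some shift improves the bound, then every active row has grown, which its
    tangent allows only with positive slope.  Conversely, close to 0 the active
    rows follow a tangent of positive slope, and the inactive rows, which start
    strictly above the bound, lose at most m x. *)
Lemma lambda_improvement A : gersh_lambda A < shifted_lambda A <->
  forall i, d_low A i 0 = gersh_lambda A ->
    improvement_threshold R n.+1 <= (npos A i)%:Z.
Proof.
split=> [lt_sup i active|improves].
  have [|_ [x /= x0 <-] lt_x] := sup_gt _ lt_sup.
    by exists (gersh_lambda (shift_ones A 0)), 0 => /=.
  rewrite threshold_le; rewrite gersh_lambda_shift in lt_x.
  have := le_trans (fmin_le (d_low A ^~ x) i) (d_low_le_tangent A i x x0).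
  rewrite active => /(lt_le_trans lt_x); rewrite ltrDl => slope_x.
  have x_gt0 : 0 < x.
    rewrite lt_neqAle x0 andbT; apply: contraTneq slope_x => <-.
    by rewrite mulr0 ltxx.
  by rewrite pmulr_lgt0// subr_gt0 in slope_x.
have lifted : \forall x \near 0^'+, forall i, gersh_lambda A < d_low A i x.
  apply: filter_forall => i.
  have := fmin_le (fun i => d_low A i 0) i; rewrite -gersh_lambdaE.
  rewrite le_eqVlt => /predU1P[active|inactive].
    have slope := improves i (esym active); rewrite threshold_le in slope.
    near=> x; have x0 : 0 < x by near: x; exact: nbhs_right_gt.
    rewrite (near (d_low_eq_tangent A i) x)// -active ltrDl mulr_gt0//.
    by rewrite subr_gt0.
  near=> x; have x0 : 0 < x by near: x; exact: nbhs_right_gt.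
  rewrite (near (d_low_eq_tangent A i) x)//.
  have : x < (d_low A i 0 - gersh_lambda A) / n.+1%:R.
    by near: x; apply: nbhs_right_lt; rewrite divr_gt0 ?subr_gt0.
  rewrite ltr_pdivlMr// => xlt.
  have : 0 <= (npos A i)%:R * x by rewrite mulr_ge0// ltW.
  by lra.
have [x [x0 xlt]] : exists x, 0 < x /\ forall i, gersh_lambda A < d_low A i x.
  apply: (@filter_ex _ (0 : R)^'+); near=> x; split.
    by near: x; exact: nbhs_right_gt.
  by near: x.
apply: lt_le_trans (shifted_lambda_ge A x (ltW x0)); rewrite gersh_lambda_shift.
by have [i <-] := fmin_attained (fun i => d_low A i x).
Unshelve. all: by end_near.
Qed.

Lemma D_up_opp A i x : D_up A i x = - d_low (- A) i (- x).
Proof.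
rewrite /D_up /d_low mxE.
rewrite (eq_bigr (fun j => `|(- A) i j - - x|)); first by ring.
by move=> j _; rewrite mxE -opprD normrN.
Qed.

Lemma gersh_rho_opp A x :
  gersh_rho (shift_ones A x) = - gersh_lambda (shift_ones (- A) (- x)).
Proof.
rewrite gersh_rho_shift gersh_lambda_shift -fmaxN.
by apply: eq_fmax => i; exact: D_up_opp.
Qed.

Lemma shifted_rho_opp A : shifted_rho A = - shifted_lambda (- A).
Proof.
rewrite /shifted_rho /inf; congr (- sup _); apply/seteqP; split=> y.
  move=> [_ [x /= x0 <-] <-]; exists (- x); first by rewrite /= oppr_ge0.
  by rewrite gersh_rho_opp opprK.
move=> [x /= x0 <-]; exists (gersh_rho (shift_ones A (- x))).
  by exists (- x) => //=; rewrite oppr_le0.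
by rewrite gersh_rho_opp !opprK.
Qed.

Lemma rho_improvement A : shifted_rho A < gersh_rho A <->
  forall i, D_up A i 0 = gersh_rho A ->
    improvement_threshold R n.+1 <= (nneg A i)%:Z.
Proof.
have shift0 (B : 'M[R]_n.+1) : shift_ones B 0 = B.
  by rewrite /shift_ones scale0r subr0.
have rhoE : gersh_rho A = - gersh_lambda (- A).
  by rewrite -[A in LHS]shift0 gersh_rho_opp oppr0 shift0.
have nnegE i : nneg A i = npos (- A) i.
  by apply: eq_card => j; rewrite !inE mxE oppr_gt0.
rewrite shifted_rho_opp rhoE ltrN2 lambda_improvement.
split=> improves i.
  by rewrite D_up_opp oppr0 nnegE => /oppr_inj; exact: improves.
by move=> active; rewrite -nnegE improves// D_up_opp oppr0 active.
Qed.

End LocalImprovement.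

(** * Minimizers of the two bounds *)

Section Minimizers.
Context {R : realType}.

(** The horizontal line is a lower bound of the maximum, attained wherever the
    other line does not exceed it. *)
Lemma minimizers_two_lines (a c : 'I_2 -> R) k l :
  k != l -> a k = 0 -> a l != 0 ->
  minimizers [set: R] (max_affine a c) = [set x | a l * x + c l <= c k].
Proof.
move=> kl ak al.
have kl_all (j : 'I_2) : j = k \/ j = l.
  have [->|jk] := eqVneq j k; [by left|right; apply/val_inj].
  case: j k l kl jk {ak al} => [[|[|//]] ?] [[|[|//]] ?] [[|[|//]] ?] //.
have ck_le x : c k <= max_affine a c x.
  by have := le_fmax (fun j => a j * x + c j) k; rewrite ak mul0r add0r.
have le_ckE x : (max_affine a c x <= c k) = (a l * x + c l <= c k).
  apply/fmax_leP/idP => [/(_ l)//|alx j]; have [->|->//] := kl_all j.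
  by rewrite ak mul0r add0r.
apply/seteqP; split=> x /=.
  move=> [_ /(_ ((c k - c l) / a l) I) xmin]; rewrite -le_ckE.
  by apply: le_trans xmin _; rewrite le_ckE mulrC divfK// subrK.
by rewrite -le_ckE => xck; split=> // y _; exact: le_trans xck (ck_le y).
Qed.

Lemma minimizers_two_lines_left (a c : 'I_2 -> R) :
  a ord0 = 0 -> 0 < a ord_max ->
  exists! p, minimizers [set: R] (max_affine a c) = `]-oo, p]%classic.
Proof.
move=> a0 a1; rewrite (@minimizers_two_lines a c ord0 ord_max)// ?gt_eqF//.
set p := (c ord0 - c ord_max) / a ord_max; exists p.
have -> : [set x | a ord_max * x + c ord_max <= c ord0] = `]-oo, p]%classic.
  by apply/seteqP; split=> x; rewrite /= in_itv/= ler_pdivlMr// lerBrDr mulrC.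
split=> // q /seteqP[/(_ p) pq /(_ q) qp]; move: pq qp.
by rewrite /= !in_itv /= !lexx => pq qp; apply/eqP; rewrite eq_le pq ?qp.
Qed.

Lemma minimizers_two_lines_right (a c : 'I_2 -> R) :
  a ord0 < 0 -> a ord_max = 0 ->
  exists! p, minimizers [set: R] (max_affine a c) = `[p, +oo[%classic.
Proof.
move=> a0 a1; rewrite (@minimizers_two_lines a c ord_max ord0)// ?lt_eqF//.
set p := (c ord_max - c ord0) / a ord0; exists p.
have -> : [set x | a ord0 * x + c ord0 <= c ord_max] = `[p, +oo[%classic.
  apply/seteqP; split=> x; rewrite /= in_itv/= andbT ler_ndivrMr//;
  by rewrite lerBrDr mulrC.
split=> // q /seteqP[/(_ p) pq /(_ q) qp]; move: pq qp.
by rewrite /= !in_itv /= !lexx !andbT => pq qp; apply/eqP; rewrite eq_le pq ?qp.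
Qed.

Context {n : nat}.
Implicit Types A : 'M[R]_n.+1.

(** The last slope -r_m = m makes the function grow at infinity. *)
Lemma minimizers_halfline_lambda A :
  min_on_unique_segment [set x : R | 0 <= x]
    (fun x => - gersh_lambda (shift_ones A x)).
Proof.
rewrite opp_gersh_lambda_shiftE; apply: max_affine_min_on_segment.
- exact: closed_ge.
- by move=> x y /= x0 _ z /andP[xz _]; exact: le_trans xz.
- by exists 0 => /=.
- by left; exists 0.
- by right; exists ord_max; rewrite /r_slope /= (mulrSr 1 n);
  have n_ge0 := ler0n R n; lra.
Qed.

(** The first slope R_1 = - m makes the function grow at minus infinity. *)
Lemma minimizers_halfline_rho A :
  min_on_unique_segment [set x : R | x <= 0]
    (fun x => gersh_rho (shift_ones A x)).
Proof.
rewrite gersh_rho_shiftE; apply: max_affine_min_on_segment.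
- exact: closed_le.
- by move=> x y /= _ y0 z /andP[_ zy]; exact: le_trans y0.
- by exists 0 => /=.
- by right; exists ord0; rewrite /R_slope /= (mulrSr 1 n);
  have n_ge0 := ler0n R n; lra.
- by left; exists 0.
Qed.

(** The extreme slopes are -r_1 = 2 - m and -r_m = m: the first one is negative
    only from m = 3 on. *)
Lemma minimizers_line_lambda A : (3 <= n.+1)%N ->
  min_on_unique_segment [set: R] (fun x => - gersh_lambda (shift_ones A x)).
Proof.
rewrite -(ler_nat R) => n3.
rewrite opp_gersh_lambda_shiftE; apply: max_affine_min_on_segment => //.
- by exists 0.
- by right; exists ord0; rewrite /r_slope /=; lra.
- by right; exists ord_max; rewrite /r_slope /=; lra.
Qed.

Lemma minimizers_line_rho A : (3 <= n.+1)%N ->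
  min_on_unique_segment [set: R] (fun x => gersh_rho (shift_ones A x)).
Proof.
rewrite -(ler_nat R) => n3.
rewrite gersh_rho_shiftE; apply: max_affine_min_on_segment => //.
- by exists 0.
- by right; exists ord0; rewrite /R_slope /=; lra.
- by right; exists ord_max; rewrite /R_slope /=; lra.
Qed.

End Minimizers.

(** The slopes are 0 and 2 for - lambda, and - 2 and 0 for rho. *)
Lemma minimizers_line_size2 {R : realType} (A : 'M[R]_2) :
  (exists! c : R, minimizers [set: R]
     (fun x => - gersh_lambda (shift_ones A x)) = `]-oo, c]%classic) /\
  (exists! c : R, minimizers [set: R]
     (fun x => gersh_rho (shift_ones A x)) = `[c, +oo[%classic).
Proof.
rewrite opp_gersh_lambda_shiftE gersh_rho_shiftE; split.
  by apply: minimizers_two_lines_left; rewrite /r_slope /=; lra.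
by apply: minimizers_two_lines_right; rewrite /R_slope /=; lra.
Qed.

Theorem theorem3p1 (R : realType) (n : nat) (A : 'M[R]_n.+1) (Asym : A^T = A) :
  (* local improvement *)
  ((gersh_lambda A < shifted_lambda A) <->
     (forall i : 'I_n.+1, d_low A i 0 = gersh_lambda A ->
        improvement_threshold R n.+1 <= (npos A i)%:Z)) /\
  ((shifted_rho A < gersh_rho A) <->
     (forall i : 'I_n.+1, D_up A i 0 = gersh_rho A ->
        improvement_threshold R n.+1 <= (nneg A i)%:Z)) /\
  (* global bounds *)
  piecewise_linear (fun x : R => gersh_lambda (shift_ones A x)) /\
  piecewise_linear (fun x : R => gersh_rho (shift_ones A x)) /\
  (forall x : R, gersh_lambda (shift_ones A x) =
     fmin (fun k : 'I_n.+1 => r_slope R n.+1 k.+1 * x + s_min A k.+1)) /\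
  (forall x : R, gersh_rho (shift_ones A x) =
     fmax (fun k : 'I_n.+1 => R_slope R n.+1 k.+1 * x + S_max A k.+1)) /\
  (* convexity *)
  convex_on_line (fun x : R => - gersh_lambda (shift_ones A x)) /\
  convex_on_line (fun x : R => gersh_rho (shift_ones A x)) /\
  (* minimizers over the half-lines of the shifted bounds *)
  min_on_unique_segment [set x : R | 0 <= x]
    (fun x : R => - gersh_lambda (shift_ones A x)) /\
  min_on_unique_segment [set x : R | x <= 0]
    (fun x : R => gersh_rho (shift_ones A x)) /\
  (* minimizers over the whole line: none exists in size 1, and they form a
     closed half-line in size 2 *)
  ((3 <= n.+1)%N ->
     min_on_unique_segment [set: R] (fun x : R => - gersh_lambda (shift_ones A x)) /\
     min_on_unique_segment [set: R] (fun x : R => gersh_rho (shift_ones A x))) /\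
  ((n.+1 = 2)%N ->
     (exists! c : R, minimizers [set: R]
        (fun x : R => - gersh_lambda (shift_ones A x)) = `]-oo, c]%classic) /\
     (exists! c : R, minimizers [set: R]
        (fun x : R => gersh_rho (shift_ones A x)) = `[c, +oo[%classic)).
Proof.
split; first exact: lambda_improvement.
split; first exact: rho_improvement.
split.
  apply: piecewise_linearN; rewrite opp_gersh_lambda_shiftE.
  exact: max_affine_piecewise_linear.
split; first by rewrite gersh_rho_shiftE; exact: max_affine_piecewise_linear.
split; first exact: gersh_lambda_shift_min.
split; first exact: gersh_rho_max_affine.
split; first by rewrite opp_gersh_lambda_shiftE; exact: max_affine_convex.
split; first by rewrite gersh_rho_shiftE; exact: max_affine_convex.
split; first exact: minimizers_halfline_lambda.
split; first exact: minimizers_halfline_rho.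
split.
  by move=> n3; split; [exact: minimizers_line_lambda|exact: minimizers_line_rho].
case: n A {Asym} => [|[|n]] A // _; exact: minimizers_line_size2.
Qed.
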